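(* Let $\alpha$ be an infinite cardinal and $I=\{X: X\subseteq\alpha,\ X\text{ finite}\}$. There exists an $\alpha$-regular ultrafilter $U$ on $I$ such that every MV-algebra $\mathbf M=(M;\oplus,\neg,0)$ with $|M|\leq\alpha$ satisfies: (1) $\mathbf M$ embeds into the ultrapower $\left(\prod_{X\in I}(\mathbb Q\cap[0,1])^{\mathbb N}\right)/U$; (2) $\mathbf M$ embeds into the ultrapower $\left(\prod_{X\in I}[0,1]^{\mathbb N}\right)/U$.
   Context: An MV-algebra is an algebra $(A,\oplus,\neg,0)$ of type $(2,1,0)$ such that $\oplus$ is commutative and associative, $x\oplus 0=x$, $\neg\neg x=x$, $x\oplus 1=1$ where $1:=\neg 0$, and $\neg(\neg x\oplus y)\oplus y=\neg(\neg y\oplus x)\oplus x$. $[0,1]$ is the standard MV-algebra on the real unit interval with $x\oplus y=\min\{x+y,1\}$, $\neg x=1-x$, and $\mathbb Q\cap[0,1]$ is its subalgebra on the rationals; $(\cdot)^{\mathbb N}$ denotes the countable direct power with pointwise operations. A proper filter $D$ on $I$ is $\alpha$-regular if there is $E\subseteq D$ with $|E|=\alpha$ such that each $i\in I$ belongs to only finitely many members of $E$. For algebras $\mathbf A_X$ and an ultrafilter $U$ on $I$, $(\prod_{X\in I}\mathbf A_X)/U$ is the quotient of the product by the congruence identifying $x,y$ iff $\{X: x(X)=y(X)\}\in U$.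
   Formalization: The MV-algebra M is additionally assumed nontrivial (0 ≠ 1), because the one-element MV-algebra satisfies the definition but cannot embed into the ultrapowers, where 0 ≠ 1. *)

(* Defs.v *)
From HB Require Import structures.
From mathcomp Require Import all_boot all_order all_algebra generic_quotient.
From mathcomp Require Import lra.
From mathcomp Require Import boolp classical_sets functions cardinality filter.
From mathcomp Require Import reals.

Set Implicit Arguments.
Unset Strict Implicit.
Unset Printing Implicit Defensive.

Import Order.TTheory GRing.Theory Num.Theory.
Local Open Scope classical_set_scope.
Local Open Scope quotient_scope.

HB.mixin Record isMVAlgebra (M : Type) := {
  mvadd : M -> M -> M;
  mvneg : M -> M;
  mv0 : M;
  mvaddC : commutative mvadd;
  mvaddA : associative mvadd;
  mvaddx0 : right_id mv0 mvadd;
  mvnegK : involutive mvneg;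
  mvaddx1 : right_zero (mvneg mv0) mvadd;
  mv_lukasiewicz : forall x y,
    mvadd (mvneg (mvadd (mvneg x) y)) y = mvadd (mvneg (mvadd (mvneg y) x)) x
}.

#[short(type="mvType")]
HB.structure Definition MVAlgebra := {M of isMVAlgebra M}.

Definition mv1 {M : mvType} : M := mvneg mv0.

Definition mv_morphism (M N : mvType) (f : M -> N) :=
  [/\ {morph f : x y / mvadd x y}, {morph f : x / mvneg x} & f mv0 = mv0].

Definition mv_embeds (M N : mvType) :=
  exists f : M -> N, mv_morphism f /\ injective f.

Section Product.
Variables (I : Type) (A : I -> mvType).

Definition mvprod := forall i, A i.
HB.instance Definition _ := gen_eqMixin mvprod.
HB.instance Definition _ := gen_choiceMixin mvprod.

Definition mvprod_add (x y : mvprod) : mvprod := fun i => mvadd (x i) (y i).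
Definition mvprod_neg (x : mvprod) : mvprod := fun i => mvneg (x i).
Definition mvprod_0 : mvprod := fun=> mv0.

Fact mvprod_addC : commutative mvprod_add.
Proof. by move=> x y; apply: functional_extensionality_dep=> i; apply: mvaddC. Qed.
Fact mvprod_addA : associative mvprod_add.
Proof. by move=> x y z; apply: functional_extensionality_dep=> i; apply: mvaddA. Qed.
Fact mvprod_addx0 : right_id mvprod_0 mvprod_add.
Proof. by move=> x; apply: functional_extensionality_dep=> i; apply: mvaddx0. Qed.
Fact mvprod_negK : involutive mvprod_neg.
Proof. by move=> x; apply: functional_extensionality_dep=> i; apply: mvnegK. Qed.
Fact mvprod_addx1 : right_zero (mvprod_neg mvprod_0) mvprod_add.
Proof. by move=> x; apply: functional_extensionality_dep=> i; apply: mvaddx1. Qed.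
Fact mvprod_lukasiewicz x y :
  mvprod_add (mvprod_neg (mvprod_add (mvprod_neg x) y)) y =
  mvprod_add (mvprod_neg (mvprod_add (mvprod_neg y) x)) x.
Proof. by apply: functional_extensionality_dep => i; apply: mv_lukasiewicz. Qed.

HB.instance Definition _ := isMVAlgebra.Build mvprod
  mvprod_addC mvprod_addA mvprod_addx0 mvprod_negK mvprod_addx1
  mvprod_lukasiewicz.
End Product.

Definition mvpow (A : mvType) (I : Type) : mvType := mvprod (fun _ : I => A).

Section ReducedProduct.
Variables (I : Type) (U : set_system I) (FU : Filter U) (A : I -> mvType).

Definition mvmod (x y : mvprod A) : bool := `[< U [set i | x i = y i] >].

Fact mvmod_refl : reflexive mvmod.
Proof. by move=> x; apply/asboolP; apply: filterE. Qed.
Fact mvmod_sym : symmetric mvmod.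
Proof.
by move=> x y; apply/asboolP/asboolP; apply: filterS => i /= ->.
Qed.
Fact mvmod_trans : transitive mvmod.
Proof.
move=> y x z /asboolP xy /asboolP yz; apply/asboolP.
by apply: filterS2 xy yz => i /= -> ->.
Qed.
Canonical mvmod_equiv := EquivRel mvmod mvmod_refl mvmod_sym mvmod_trans.

Definition mvredprod := {eq_quot mvmod}.
HB.instance Definition _ := Choice.on mvredprod.
HB.instance Definition _ := EqQuotient.on mvredprod.

Definition mvredprod_add := lift_op2 mvredprod (@mvadd (mvprod A)).
Definition mvredprod_neg := lift_op1 mvredprod (@mvneg (mvprod A)).
Definition mvredprod_0 := lift_cst mvredprod (@mv0 (mvprod A)).

Fact pi_mvredprod_add :
  {morph \pi : x y / mvadd x y >-> mvredprod_add x y}.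
Proof.
unlock mvredprod_add => x y; apply/eqmodP/asboolP.
have /asboolP xE : mvmod x (repr (\pi_mvredprod x))
  by apply/eqmodP; rewrite reprK.
have /asboolP yE : mvmod y (repr (\pi_mvredprod y))
  by apply/eqmodP; rewrite reprK.
apply: filterS2 xE yE => i /= xE yE.
by rewrite /mvadd /= /mvprod_add -xE -yE.
Qed.
Canonical pi_mvredprod_add_morph := PiMorph2 pi_mvredprod_add.

Fact pi_mvredprod_neg : {morph \pi : x / mvneg x >-> mvredprod_neg x}.
Proof.
unlock mvredprod_neg => x; apply/eqmodP/asboolP.
have /asboolP xE : mvmod x (repr (\pi_mvredprod x))
  by apply/eqmodP; rewrite reprK.
by apply: filterS xE => i /= xE; rewrite /mvneg /= /mvprod_neg -xE.
Qed.
Canonical pi_mvredprod_neg_morph := PiMorph1 pi_mvredprod_neg.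
Canonical pi_mvredprod_0_morph := PiConst mvredprod_0.

Fact mvredprod_addC : commutative mvredprod_add.
Proof. by elim/quotW=> x; elim/quotW=> y; rewrite !piE mvaddC. Qed.
Fact mvredprod_addA : associative mvredprod_add.
Proof.
by elim/quotW=> x; elim/quotW=> y; elim/quotW=> z; rewrite !piE mvaddA.
Qed.
Fact mvredprod_addx0 : right_id mvredprod_0 mvredprod_add.
Proof. by elim/quotW=> x; rewrite !piE mvaddx0. Qed.
Fact mvredprod_negK : involutive mvredprod_neg.
Proof. by elim/quotW=> x; rewrite !piE mvnegK. Qed.
Fact mvredprod_addx1 :
  right_zero (mvredprod_neg mvredprod_0) mvredprod_add.
Proof. by elim/quotW=> x; rewrite !piE mvaddx1. Qed.
Fact mvredprod_lukasiewicz x y :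
  mvredprod_add (mvredprod_neg (mvredprod_add (mvredprod_neg x) y)) y =
  mvredprod_add (mvredprod_neg (mvredprod_add (mvredprod_neg y) x)) x.
Proof.
by elim/quotW: x => x; elim/quotW: y => y; rewrite !piE mv_lukasiewicz.
Qed.

HB.instance Definition _ := isMVAlgebra.Build mvredprod
  mvredprod_addC mvredprod_addA mvredprod_addx0 mvredprod_negK
  mvredprod_addx1 mvredprod_lukasiewicz.
End ReducedProduct.

Definition mvultraprod (I : Type) (U : set_system I) (UU : UltraFilter U)
  (A : I -> mvType) : mvType := @mvredprod I U _ A.

Section UnitInterval.
Local Open Scope ring_scope.
Variable F : realFieldType.

Record unitI := UnitI { unitI_val : F; unitI_valP : 0 <= unitI_val <= 1 }.
HB.instance Definition _ := [isSub for unitI_val].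

Fact unitI_add_subproof (x y : unitI) : 0 <= Num.min (val x + val y) 1 <= 1.
Proof.
case: x y => [x /= /andP[? ?]] [y /= /andP[? ?]].
by rewrite ge_min lexx orbT andbT le_min ler01 andbT addr_ge0.
Qed.
Fact unitI_neg_subproof (x : unitI) : 0 <= 1 - val x <= 1.
Proof. by case: x => [x /= /andP[? ?]]; apply/andP; split; lra. Qed.
Fact unitI_0_subproof : (0 : F) <= (0 : F) <= (1 : F).
Proof. by rewrite lexx ler01. Qed.

Definition unitI_add (x y : unitI) : unitI :=
  @UnitI (Num.min (val x + val y) 1) (unitI_add_subproof x y).
Definition unitI_neg (x : unitI) : unitI :=
  @UnitI (1 - val x) (unitI_neg_subproof x).
Definition unitI_0 : unitI := @UnitI 0 unitI_0_subproof.

Fact unitI_addC : commutative unitI_add.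
Proof. by move=> x y; apply: val_inj; rewrite /= addrC. Qed.
Fact unitI_addA : associative unitI_add.
Proof.
move=> [x xP] [y yP] [z zP]; apply: val_inj => /=.
move: xP yP zP => /andP[? ?] /andP[? ?] /andP[? ?].
by case: (leP (x + y)) => ?; case: (leP (y + z)) => ?; do !case: leP => ?; lra.
Qed.
Fact unitI_addx0 : right_id unitI_0 unitI_add.
Proof.
by move=> [x xP]; apply: val_inj => /=; case/andP: xP => ? ?;
  case: leP => ?; lra.
Qed.
Fact unitI_negK : involutive unitI_neg.
Proof. by move=> x; apply: val_inj; rewrite /= subKr. Qed.
Fact unitI_addx1 : right_zero (unitI_neg unitI_0) unitI_add.
Proof.
by move=> [x xP]; apply: val_inj => /=; case/andP: xP => ? ?;
  case: leP => ?; lra.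
Qed.
Fact unitI_lukasiewicz x y :
  unitI_add (unitI_neg (unitI_add (unitI_neg x) y)) y =
  unitI_add (unitI_neg (unitI_add (unitI_neg y) x)) x.
Proof.
case: x y => [x xP] [y yP]; apply: val_inj => /=.
move: xP yP => /andP[? ?] /andP[? ?].
by case: (leP (1 - x + y)) => ?; case: (leP (1 - y + x)) => ?;
  do !case: leP => ?; lra.
Qed.

HB.instance Definition _ := isMVAlgebra.Build unitI
  unitI_addC unitI_addA unitI_addx0 unitI_negK unitI_addx1 unitI_lukasiewicz.
End UnitInterval.

(* [unitI rat] stands for the subalgebra of rationals in [unitI R]: [ratr]
   restricts to an embedding whose image is the set of rational points. *)
Fact unitI_rat_subalgebra (R : realFieldType) :
  exists f : unitI rat -> unitI R,
    [/\ mv_morphism f, injective f & forall y : unitI R,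
      (exists x, f x = y) <-> exists q : rat, val y = ratr q].
Proof.
have fP (x : unitI rat) : (0 <= (ratr (val x) : R) <= 1)%R.
  by rewrite ler0q -(rmorph1 (@ratr R)) ler_rat; exact: unitI_valP.
exists (fun x => UnitI (fP x)); split.
- split=> [x y|x|]; apply: val_inj => /=.
  + by rewrite minr_rat rmorphD rmorph1.
  + by rewrite rmorphB rmorph1.
  + by rewrite rmorph0.
- by move=> x y /(congr1 val) /= /fmorph_inj /val_inj.
- move=> y; split=> [[x <-]|[q yq]]; first by exists (val x).
  have qP : (0 <= q <= 1)%R 
    by rewrite -(ler0q R) -(ler_rat R) rmorph1 -yq; exact: unitI_valP.
  by exists (UnitI qP); apply: val_inj.
Qed.

Definition finsubset (K : Type) := {X : set K | finite_set X}.

(* The cardinal alpha is given by a type K of that cardinality. *)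
Definition regular_filter (K I : Type) (D : set_system I) :=
  ProperFilter D /\
  exists E : set (set I), [/\ E `<=` D, (E #= [set: K])%card &
    forall i, finite_set [set S | E S /\ S i]].

(* Main.v *)
Require Import Defs.
From HB Require Import structures.
From mathcomp Require Import all_boot all_order all_algebra generic_quotient.
From mathcomp Require Import lra.
From mathcomp Require Import boolp classical_sets functions cardinality filter.
From mathcomp Require Import reals.

(** As [U] contains every [{X | k \in X}], it suffices to map every finite
    [F `<=` M] injectively into [(unitI rat)^nat], respecting the operations
    as far as they stay in [F]; one coordinate per pair [a <> b] in [F] then
    reduces to separating [a] from [b] by a partial morphism [F -> unitI rat].
    An ideal that is maximal among those avoiding [a - b] (or [b - a]) is
    prime, so [M] may be replaced by a chain [C]. Finite sums over [C] can be
    compared in the ordered group of which [C] is the unit interval, written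
    as carries [n + z]. The partial morphism is a solution of finitely many
    linear constraints, and Fourier-Motzkin elimination transfers solvability
    from that group to the rationals. *)

Set Implicit Arguments.
Unset Strict Implicit.
Unset Printing Implicit Defensive.

Import Order.TTheory GRing.Theory Num.Theory.
Local Open Scope classical_set_scope.
Local Open Scope quotient_scope.

(** * Arithmetic of MV-algebras *)

Section MVTheory.
Variable M : mvType.
Implicit Types x y z t u v w : M.

(** In [[0,1]] these are [max(x + y - 1, 0)], [max(x - y, 0)], the usual order and [min]. *)
Definition mvmul x y := mvneg (mvadd (mvneg x) (mvneg y)).
Definition mvsub x y := mvmul x (mvneg y).
Definition mvle x y := mvadd (mvneg x) y = mv1.
Definition mvmeet x y := mvmul x (mvadd (mvneg x) y).

Lemma mvneg1 : mvneg mv1 = mv0 :> M. Proof. exact: mvnegK. Qed.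

Lemma mvadd0x x : mvadd mv0 x = x. Proof. by rewrite mvaddC mvaddx0. Qed.

Lemma mvadd1x x : mvadd mv1 x = mv1. Proof. by rewrite mvaddC mvaddx1. Qed.

Lemma mvaddCA x y z : mvadd x (mvadd y z) = mvadd y (mvadd x z).
Proof. by rewrite !mvaddA (mvaddC x). Qed.

Lemma mvaddAC x y z : mvadd (mvadd x y) z = mvadd (mvadd x z) y.
Proof. by rewrite -!mvaddA (mvaddC y). Qed.

Lemma mvaddNx x : mvadd (mvneg x) x = mv1.
Proof.
by have := mv_lukasiewicz x mv1; rewrite !mvaddx1 mvnegK mvadd0x.
Qed.

Lemma mvaddxN x : mvadd x (mvneg x) = mv1.
Proof. by rewrite mvaddC mvaddNx. Qed.

Lemma mvmulC x y : mvmul x y = mvmul y x.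
Proof. by rewrite /mvmul mvaddC. Qed.

Lemma mvmulA x y z : mvmul x (mvmul y z) = mvmul (mvmul x y) z.
Proof. by rewrite /mvmul !mvnegK mvaddA. Qed.

Lemma mvmulCA x y z : mvmul x (mvmul y z) = mvmul y (mvmul x z).
Proof. by rewrite !mvmulA (mvmulC x). Qed.

Lemma mvmulxN x : mvmul x (mvneg x) = mv0.
Proof. by rewrite /mvmul mvnegK mvaddNx mvneg1. Qed.

Lemma mvmulx1 x : mvmul x mv1 = x.
Proof. by rewrite /mvmul mvneg1 mvaddx0 mvnegK. Qed.

Lemma mvmulx0 x : mvmul x mv0 = mv0.
Proof. by rewrite /mvmul mvaddx1 mvneg1. Qed.

Lemma mvlexx x : mvle x x. Proof. exact: mvaddNx. Qed.

(** One side of the Lukasiewicz axiom collapses to [y] when [mvadd (mvneg x) y = mv1]. This turns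
    the order into divisibility by addition. *)
Lemma mvle_subK x y : mvle x y -> mvadd x (mvmul y (mvneg x)) = y.
Proof.
move=> xy; have := mv_lukasiewicz x y; rewrite xy mvneg1 mvadd0x.
by rewrite /mvmul mvnegK => {2}->; rewrite mvaddC.
Qed.

Lemma mvle_addr x y : mvle x (mvadd x y).
Proof. by rewrite /mvle mvaddA mvaddNx mvadd1x. Qed.

Lemma mvle_addl x y : mvle x (mvadd y x).
Proof. by rewrite mvaddC; exact: mvle_addr. Qed.

Lemma mvle_trans y x z : mvle x y -> mvle y z -> mvle x z.
Proof.
move=> /mvle_subK <- /mvle_subK <-; rewrite -mvaddA; exact: mvle_addr.
Qed.

Lemma mvle_anti x y : mvle x y -> mvle y x -> x = y.
Proof.
move=> xy yx; have := mv_lukasiewicz x y.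
by rewrite xy yx mvneg1 !mvadd0x.
Qed.

Lemma mvle0x x : mvle mv0 x. Proof. exact: mvadd1x. Qed.

Lemma mvlex1 x : mvle x mv1. Proof. exact: mvaddx1. Qed.

Lemma mvlex0 x : mvle x mv0 -> x = mv0.
Proof. by move=> /mvle_anti; apply; exact: mvle0x. Qed.

Lemma mvle_neg x y : mvle x y -> mvle (mvneg y) (mvneg x).
Proof. by rewrite /mvle mvnegK mvaddC. Qed.

Lemma mvle_add2l z x y : mvle x y -> mvle (mvadd z x) (mvadd z y).
Proof. by move=> /mvle_subK <-; rewrite mvaddA; exact: mvle_addr. Qed.

Lemma mvle_add x y z w :
  mvle x y -> mvle z w -> mvle (mvadd x z) (mvadd y w).
Proof.
move=> xy zw; apply: (@mvle_trans (mvadd x w)); first exact: mvle_add2l.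
by rewrite -!(mvaddC w); exact: mvle_add2l.
Qed.

Lemma mvle_mul2l z x y : mvle x y -> mvle (mvmul z x) (mvmul z y).
Proof. by move=> xy; apply: mvle_neg; apply: mvle_add2l; exact: mvle_neg. Qed.

Lemma mvle_mulr x y : mvle (mvmul x y) x.
Proof. by rewrite /mvle /mvmul mvnegK mvaddAC mvaddNx mvadd1x. Qed.

Lemma mvle_mull x y : mvle (mvmul y x) x.
Proof. by rewrite mvmulC; exact: mvle_mulr. Qed.

Lemma mvle_mulP x y z : mvle (mvmul x y) z <-> mvle x (mvadd (mvneg y) z).
Proof. by rewrite /mvle /mvmul mvnegK mvaddA. Qed.

Lemma mvle_subP x y z : mvle (mvsub x y) z <-> mvle x (mvadd y z).
Proof. by rewrite /mvsub mvle_mulP mvnegK. Qed.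

Lemma mvle_sub_addr x y : mvle x (mvadd y (mvsub x y)).
Proof. exact/mvle_subP/mvlexx. Qed.

Lemma mvsub_eq0 x y : mvsub x y = mv0 -> mvle x y.
Proof. by rewrite -{2}[y]mvaddx0 -mvle_subP => ->; exact: mvlexx. Qed.

(** Dual of [mvle_subK] under negation: below [mvneg y], addition of [y] does not truncate and can
    be cancelled. *)
Lemma mvlexN_subK x y : mvle x (mvneg y) -> mvmul (mvneg y) (mvadd y x) = x.
Proof.
move=> /mvle_neg; rewrite mvnegK => /mvle_subK /(congr1 mvneg).
by rewrite /mvmul !mvnegK => {2}<-; rewrite (mvaddC x).
Qed.

Lemma mvle_meetl x y : mvle (mvmeet x y) x. Proof. exact: mvle_mulr. Qed.

Lemma mvle_meetr x y : mvle (mvmeet x y) y.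
Proof. by rewrite /mvmeet mvmulC; apply/mvle_mulP; exact: mvlexx. Qed.

Lemma mvle_meet t x y : mvle t x -> mvle t y -> mvle t (mvmeet x y).
Proof.
move=> tx ty; rewrite -[t](mvlexN_subK (y := mvneg x)) ?mvnegK//.
by apply: mvle_mul2l; exact: mvle_add2l.
Qed.

(** Addition of [x] is right adjoint to [mvsub _ x], hence preserves meets. *)
Lemma mvle_add_meet t x y z :
  mvle t (mvadd x y) -> mvle t (mvadd x z) -> mvle t (mvadd x (mvmeet y z)).
Proof.
by rewrite -!mvle_subP; exact: mvle_meet.
Qed.

Lemma mvle_meet_add x y z :
  mvle (mvmeet (mvadd x y) z) (mvadd (mvmeet x z) (mvmeet y z)).
Proof.
set t := mvmeet _ z.
have tz : mvle t z := mvle_meetr _ _.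
rewrite mvaddC; apply: mvle_add_meet; rewrite mvaddC; apply: mvle_add_meet.
- exact: mvle_meetl.
- exact: mvle_trans tz (mvle_addl _ _).
- exact: mvle_trans tz (mvle_addr _ _).
- exact: mvle_trans tz (mvle_addr _ _).
Qed.

(** Adding the common part [t] of the two differences to [m] stays below both [x] and [y], hence
    below [m]. Since [t] is below [mvneg m], [m] cancels and [t] vanishes. *)
Lemma mvsub_meet0 x y : mvmeet (mvsub x y) (mvsub y x) = mv0.
Proof.
apply: mvlex0; set t := mvmeet _ _; set m := mvmeet x y.
have tNm : mvle t (mvneg m).
  apply: (mvle_trans (mvle_meetl _ _)); apply: (mvle_trans (mvle_mull _ _)).
  exact/mvle_neg/mvle_meetr.
have tle z w : mvle m z -> mvle m w -> mvle t (mvsub w z) ->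
    mvle (mvadd m t) w.
  move=> mz mw tw; rewrite -(mvle_subK mw); apply: mvle_add2l.
  apply: (mvle_trans tw); exact/mvle_mul2l/mvle_neg.
rewrite -(mvlexN_subK tNm) -(mvmulxN (mvneg m)) mvnegK.
apply: mvle_mul2l; apply: mvle_meet.
- by apply: (tle y); [exact: mvle_meetr|exact: mvle_meetl|exact: mvle_meetl].
- by apply: (tle x); [exact: mvle_meetl|exact: mvle_meetr|exact: mvle_meetr].
Qed.

End MVTheory.

(** * Separation by chains *)

Section Quotient.
Variables (M : mvType) (E : M -> M -> Prop).
Hypothesis Erefl : forall x, E x x.
Hypothesis Esym : forall x y, E x y -> E y x.
Hypothesis Etrans : forall y x z, E x y -> E y z -> E x z.
Hypothesis Eadd : forall x y z w, E x y -> E z w -> E (mvadd x z) (mvadd y w).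
Hypothesis Eneg : forall x y, E x y -> E (mvneg x) (mvneg y).

(** The choice made by [cid] depends only on the predicate [E x], so it is constant on classes. The
    quotient consists of the fixed points of [rep]. *)
Let rep (x : M) : M := projT1 (cid (ex_intro (E x) x (Erefl x))).

Let repE x : E x (rep x). Proof. exact: projT2 (cid _). Qed.

Let rep_eq x y : E x y -> rep x = rep y.
Proof.
move=> xy; rewrite /rep.
have EE : E x = E y.
  by apply/funext => z; apply/propext; split; apply: Etrans => //; exact: Esym.
move: (ex_intro (E x) x (Erefl x)) (ex_intro (E y) y (Erefl y)).
by rewrite EE => p q; rewrite (Prop_irrelevance p q).
Qed.

Let Q := {x : M | rep x = x}.
Let pi (x : M) : Q := exist _ (rep x) (rep_eq (Esym (repE x))).

Let pi_eq x y : E x y -> pi x = pi y.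
Proof. by move=> /rep_eq xy; exact: eq_exist. Qed.

Let piK (p : Q) : pi (sval p) = p.
Proof. by case: p => x xP; exact: eq_exist. Qed.

Let pi_inj x y : pi x = pi y -> E x y.
Proof.
move=> /(congr1 sval)/= xy; apply: Etrans (repE x) _; rewrite xy.
exact/Esym/repE.
Qed.

Let qadd (p q : Q) := pi (mvadd (sval p) (sval q)).
Let qneg (p : Q) := pi (mvneg (sval p)).

Let pi_add x y : qadd (pi x) (pi y) = pi (mvadd x y).
Proof. by apply: pi_eq; apply: Esym; apply: Eadd; exact: repE. Qed.

Let pi_neg x : qneg (pi x) = pi (mvneg x).
Proof. by apply: pi_eq; apply: Esym; apply: Eneg; exact: repE. Qed.

Lemma mv_quotient : exists (C : mvType) (f : M -> C),
  [/\ mv_morphism f, forall x y, f x = f y <-> E x y &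
      forall z, exists x, f x = z].
Proof.
have qaddC : commutative qadd.
  by move=> p q; rewrite -(piK p) -(piK q) !pi_add mvaddC.
have qaddA : associative qadd.
  by move=> p q r; rewrite -(piK p) -(piK q) -(piK r) !pi_add mvaddA.
have qaddx0 : right_id (pi mv0) qadd.
  by move=> p; rewrite -(piK p) !pi_add mvaddx0.
have qnegK : involutive qneg by move=> p; rewrite -(piK p) !pi_neg mvnegK.
have qaddx1 : right_zero (qneg (pi mv0)) qadd.
  by move=> p; rewrite -(piK p) pi_neg pi_add mvaddx1.
have qluk p q : qadd (qneg (qadd (qneg p) q)) q =
                qadd (qneg (qadd (qneg q) p)) p.
  by rewrite -(piK p) -(piK q) !(pi_add, pi_neg) mv_lukasiewicz.
pose mix := isMVAlgebra.Build Q qaddC qaddA qaddx0 qnegK qaddx1 qluk.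
pose C : mvType := HB.pack Q mix.
exists C, pi; split; [split|..].
- by move=> x y; rewrite -pi_add.
- by move=> x; rewrite -pi_neg.
- by [].
- by move=> x y; split; [exact: pi_inj|exact: pi_eq].
- by move=> z; exists (sval z); exact: piK.
Qed.

End Quotient.

Section PrimeIdeal.
Variable M : mvType.
Implicit Types (x y z : M) (J : set M).

Definition mv_preideal J :=
  (forall x y, mvle x y -> J y -> J x) /\
  (forall x y, J x -> J y -> J (mvadd x y)).

Lemma mv_preideal_polar J u :
  mv_preideal J -> mv_preideal [set x | J (mvmeet x u)].
Proof.
move=> [Jle Jadd]; split=> [x y xy|x y Jx Jy] /=.
  apply: Jle; apply: mvle_meet; last exact: mvle_meetr.
  exact: mvle_trans (mvle_meetl _ _) xy.
exact: Jle (mvle_meet_add _ _ _) (Jadd _ _ Jx Jy).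
Qed.

Lemma mv_prime_ideal (d : M) : d <> mv0 -> exists J,
  [/\ mv_preideal J, J mv0, ~ J d & forall x y, J (mvsub x y) \/ J (mvsub y x)].
Proof.
move=> d0; pose P J := mv_preideal J /\ ~ J d.
have [J [[idJ Jd] Jmax]] : exists J, P J /\ forall B, J `<` B -> ~ P B.
  apply: Zorn_bigcup => F FP Ftot; split; last by move=> [X /FP[_ Xd]] /Xd.
  split=> [x y xy [X FX Xy]|x y [X FX Xx] [Y FY Yy]].
    by exists X => //; have [[+ _] _] := FP _ FX; apply; first exact: xy.
  have [XY|YX] := Ftot X Y FX FY.
    by exists Y => //; have [[_ +] _] := FP _ FY; apply => //; exact: XY.
  by exists X => //; have [[_ +] _] := FP _ FX; apply => //; exact: YX.
have [Jle Jadd] := idJ.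
have J0 : J mv0.
  apply: contrapT => J0; apply: (Jmax [set mv0]).
    split=> [x Jx|/(_ mv0 erefl)//]; exfalso; apply: J0.
    exact: Jle (mvle0x _) Jx.
  split; last by move=> /= dE; exact: d0.
  split=> [x y /[swap] /= ->|x y /= -> ->]; last by rewrite mvaddx0.
  exact: mvlex0.
exists J; split=> // x y; apply: contrapT => /not_orP[Jxy Jyx].
(* Maximality forces [d] into the polar of every element outside [J], hence,
   exchanging roles, [d] into its own polar. *)
have polar u v : ~ J v -> J (mvmeet v u) -> J (mvmeet d u).
  move=> Jv Jvu; apply: contrapT => Jdu.
  apply: (Jmax [set x | J (mvmeet x u)]).
    split=> [z Jz|/(_ v Jvu)//]; exact: Jle (mvle_meetl _ _) Jz.
  by split=> //; exact: mv_preideal_polar.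
have meetC z w : J (mvmeet z w) -> J (mvmeet w z).
  by apply: Jle; apply: mvle_meet; [exact: mvle_meetr|exact: mvle_meetl].
have Jdd : J (mvmeet d d).
  apply: (polar _ (mvsub x y)) => //; apply/meetC/(polar _ (mvsub y x)) => //.
  by rewrite mvsub_meet0.
by apply: Jd; apply: Jle Jdd; apply: mvle_meet; exact: mvlexx.
Qed.

(** Triangle inequality. Together with [mvle_subD] it makes lying at a distance in [J] a
    congruence. *)
Lemma mvle_sub_trans y x z : mvle (mvsub x z) (mvadd (mvsub x y) (mvsub y z)).
Proof.
apply/mvle_subP; rewrite mvaddCA.
apply: (@mvle_trans _ (mvadd (mvsub x y) y)).
  by rewrite mvaddC; exact: mvle_sub_addr.
exact/mvle_add2l/mvle_sub_addr.
Qed.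

Lemma mvle_subD x y z w : mvle (mvsub (mvadd x z) (mvadd y w))
  (mvadd (mvsub x y) (mvsub z w)).
Proof.
apply/mvle_subP; rewrite mvaddA -(mvaddA y) (mvaddC w) !mvaddA -mvaddA.
by apply: mvle_add; exact: mvle_sub_addr.
Qed.

End PrimeIdeal.

Lemma mv_chain_separation (M : mvType) (a b : M) : a <> b ->
  exists (C : mvType) (f : M -> C),
    [/\ mv_morphism f, forall x y : C, mvle x y \/ mvle y x & f a <> f b].
Proof.
move=> ab; have [d [d0 dab]] : exists d : M, d <> mv0 /\
    (d = mvsub a b \/ d = mvsub b a).
  have [ab0|] := pselect (mvsub a b = mv0); last by exists (mvsub a b); auto.
  have [ba0|] := pselect (mvsub b a = mv0); last by exists (mvsub b a); auto.
  by case: ab; apply: mvle_anti; exact: mvsub_eq0.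
have [J [[Jle Jadd] J0 Jd Jprime]] := mv_prime_ideal d0.
pose E (x y : M) := J (mvsub x y) /\ J (mvsub y x).
have Erefl x : E x x by split; rewrite /mvsub mvmulxN.
have Esym x y : E x y -> E y x by case.
have Etrans y x z : E x y -> E y z -> E x z.
  move=> [xy yx] [yz zy]; split; apply: Jle (mvle_sub_trans y _ _) _;
  exact: Jadd.
have Eadd x y z w : E x y -> E z w -> E (mvadd x z) (mvadd y w).
  move=> [xy yx] [zw wz]; split; apply: Jle (mvle_subD _ _ _ _) _;
  exact: Jadd.
have Eneg x y : E x y -> E (mvneg x) (mvneg y).
  by move=> [xy yx]; split; rewrite /mvsub mvnegK mvmulC.
have [C [f [fM fE fsurj]]] := mv_quotient Erefl Esym Etrans Eadd Eneg.
exists C, f; split=> //; last first.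
  by move=> /fE[Jab Jba]; case: dab => dE; apply: Jd; rewrite dE.
have [fadd fneg f0] := fM.
(* The order on [C] is an equation [f (mvadd (mvneg x) y) = f mv1], and the difference of the two
   arguments is [mvsub x y]. Primeness of [J] thus becomes totality. *)
have fle x y : J (mvsub x y) -> mvle (f x) (f y).
  move=> Jxy; rewrite /mvle /mv1 -fneg -fadd -f0 -fneg; apply/fE.
  split; first by rewrite /mvsub mvnegK mvmulx0.
  rewrite /mvsub mvmulC mvmulx1; move: Jxy.
  by rewrite /mvsub /mvmul mvnegK.
move=> u v; have [[x <-] [y <-]] := (fsurj u, fsurj v).
by have [/fle|/fle] := Jprime x y; [left|right].
Qed.

(** * Linear constraints *)

Section FourierMotzkin.
Local Open Scope ring_scope.

Lemma max_seq (F : realFieldType) (s : seq F) : s != [::] ->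
  exists2 m, m \in s & forall x, x \in s -> x <= m.
Proof.
elim: s => // x s IH _; have [->|/IH[m ms mP]] := eqVneq s [::].
  by exists x => [|y]; rewrite inE // => /eqP ->.
have [xm|mx] := leP x m.
  by exists m => [|y]; rewrite inE ?ms ?orbT // => /predU1P[->//|/mP].
exists x => [|y]; rewrite inE ?eqxx // => /predU1P[->//|/mP ym].
exact: le_trans ym (ltW mx).
Qed.

Definition ltle (F : realFieldType) (s : bool) (x y : F) :=
  if s then x < y else x <= y.

Lemma ltleW (F : realFieldType) s (x y : F) : ltle s x y -> x <= y.
Proof. by case: s => // /ltW. Qed.

Lemma lt_ltle (F : realFieldType) s (x y : F) : x < y -> ltle s x y.
Proof. by case: s => // /ltW. Qed.

Lemma ltle_pick (F : realFieldType) (lo up : seq (F * bool)) :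
  (forall l u, l \in lo -> u \in up -> ltle (l.2 || u.2) l.1 u.1) ->
  exists x, (forall l, l \in lo -> ltle l.2 l.1 x) /\
            (forall u, u \in up -> ltle u.2 x u.1).
Proof.
move=> lu.
have maxlo : lo != [::] ->
    exists2 m, m \in lo & forall l, l \in lo -> l.1 <= m.1.
  move=> lo0; have [|m /mapP[m' m'lo ->] mP] := @max_seq F (map fst lo).
  - by case: (lo) lo0.
  - by exists m' => // l llo; apply: mP; exact: map_f.
have minup : up != [::] ->
    exists2 m, m \in up & forall u, u \in up -> m.1 <= u.1.
  move=> up0; have [|m /mapP[m' m'up ->] mP] :=
    @max_seq F (map (fun u => - u.1) up).
  - by case: (up) up0.
  - exists m' => // u uup; rewrite -lerN2; apply: mP.
    exact: (map_f (fun u : F * bool => - u.1)).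
have [lo0|/maxlo[m mlo mP]] := eqVneq lo [::].
  have [up0|/minup[n nup nP]] := eqVneq up [::].
    by exists 0; rewrite lo0 up0.
  exists (n.1 - 1); rewrite lo0; split=> // u /nP nu; apply: lt_ltle; lra.
have [up0|/minup[n nup nP]] := eqVneq up [::].
  exists (m.1 + 1); rewrite up0; split=> // l /mP lm; apply: lt_ltle; lra.
(* If the extreme bounds coincide, their value is the only candidate; a strict bound equal to it is
   excluded by [lu] applied with the opposite extreme. *)
have := ltleW (lu _ _ mlo nup); rewrite le_eqVlt => /predU1P[mn|mn].
  exists m.1; split=> [l llo|u uup].
    have := mP _ llo; have := lu _ _ llo nup; rewrite -mn.
    by case: (l.2); rewrite //= => /ltleW.
  have := nP _ uup; have := lu _ _ mlo uup; rewrite -mn.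
  by case: (u.2); rewrite //= ?orbT // => /ltleW.
exists ((m.1 + n.1) / 2); split=> [l /mP lm|u /nP nu]; apply: lt_ltle; lra.
Qed.

Variable T : eqType.

(* [(l, s)] stands for the homogeneous constraint [0 < l] or [0 <= l],
   according to whether [s] holds. *)
Definition constr := ((T -> int) * bool)%type.

Implicit Types (c d : constr) (F : seq T) (q : T -> rat).

Definition addc c d : constr := (fun t => c.1 t + d.1 t, c.2 || d.2).
Definition mulc (k : nat) c : constr := (fun t => k%:Z * c.1 t, c.2).
Definition evalc F q c : rat := \sum_(t <- F) (c.1 t)%:~R * q t.

Lemma evalcD F q c d : evalc F q (addc c d) = evalc F q c + evalc F q d.
Proof.
by rewrite -big_split /=; apply: eq_bigr => t _; rewrite rmorphD mulrDl.
Qed.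

Lemma evalcM F q k c : evalc F q (mulc k c) = k%:R * evalc F q c.
Proof.
rewrite /evalc big_distrr /=; apply: eq_bigr => t _.
by rewrite rmorphM /= mulrA.
Qed.

(* Fourier-Motzkin elimination. Only the closure of [V] under addition is
   needed, since the constraints are combined with natural weights. *)
Lemma additive_constr_sat F (V : set constr) (L : seq constr) : uniq F ->
  (forall c d, V c -> V d -> V (addc c d)) ->
  (forall c, V c -> c.2 -> exists2 t, t \in F & c.1 t != 0) ->
  (forall c, c \in L -> V c) ->
  exists q, forall c, c \in L -> ltle c.2 0 (evalc F q c).
Proof.
elim: F V L => [|t F IH] V L /=.
  (* Without variables every form is zero, and [Vs] rules out strict constraints. *)
  move=> _ _ Vs LV; exists (fun=> 0) => c /LV Vc; rewrite /evalc big_nil.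
  by case: c Vc => l [] //= /Vs[].
move=> /andP[tF uF] Vadd Vs LV.
have Vmul k c : V c -> V (mulc k.+1 c).
  move=> Vc; elim: k => [|k]; last move=> /(Vadd _ _ Vc).
    by congr V: Vc; case: c => l s; congr pair; apply/funext => i;
    rewrite mul1r.
  congr V; rewrite /addc/mulc /= orbb; congr pair; apply/funext => i.
  by rewrite -[in RHS]addn1 PoszD mulrDl mul1r addrC.
(* The weights cancel the coefficient of [t]; they are positive for [p] in [P] and [n] in [N], so
   [Vmul] applies. *)
pose comb p n := addc (mulc `|n.1 t|%N p) (mulc `|p.1 t|%N n).
pose P := [seq c <- L | 0 < c.1 t]; pose N := [seq c <- L | c.1 t < 0].
pose L' := [seq c <- L | c.1 t == 0] ++ [seq comb p n | p <- P, n <- N].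
pose V' := V `&` [set c | c.1 t = 0].
have [| | |q qP] := IH V' L' uF.
- move=> c d [Vc c0] [Vd d0]; split; first exact: Vadd.
  by rewrite /= c0 d0 addr0.
- move=> c [Vc c0] c2; have [u] := Vs c Vc c2; rewrite inE.
  by move=> /predU1P[->|]; [rewrite c0 eqxx|exists u].
- move=> c; rewrite mem_cat => /orP[|/allpairsP[[p n] /= [pP nN ->]]].
    by rewrite mem_filter => /andP[/eqP c0 /LV].
  move: pP nN; rewrite !mem_filter => /andP[p0 /LV Vp] /andP[n0 /LV Vn].
  split; last first.
    by rewrite /= !abszE (gtr0_norm p0) (ltr0_norm n0) mulNr mulrC addNr.
  have : (0 < `|n.1 t|)%N by rewrite absz_gt0 lt_eqF.
  have : (0 < `|p.1 t|)%N by rewrite absz_gt0 gt_eqF.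
  rewrite /comb; case: `|p.1 t|%N => // i _; case: `|n.1 t|%N => // j _.
  by apply: Vadd; exact: Vmul.
(* Solved for the value at [t], constraints in [P] are lower bounds and those in [N] upper bounds;
   their compatibility is the constraint [comb p n]. *)
pose lo := [seq (- evalc F q p / (p.1 t)%:~R, p.2) | p <- P].
pose up := [seq (- evalc F q n / (n.1 t)%:~R, n.2) | n <- N].
have [|x [xlo xup]] := @ltle_pick rat lo up.
  move=> _ _ /mapP[p pP ->] /mapP[n nN ->] /=.
  have := qP (comb p n); rewrite mem_cat.
  have -> : comb p n \in [seq comb p n | p <- P, n <- N].
    by apply/allpairsP; exists (p, n).
  rewrite orbT evalcD !evalcM => /(_ isT).
  move: pP nN; rewrite !mem_filter => /andP[p0 _] /andP[n0 _].
  rewrite !natr_absz (gtr0_norm p0) (ltr0_norm n0) rmorphN /=.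
  have {}p0 : (0 : rat) < (p.1 t)%:~R by rewrite ltr0z.
  have {}n0 : (n.1 t)%:~R < (0 : rat) by rewrite ltrz0.
  set a := (p.1 t)%:~R in p0 *; set b := (n.1 t)%:~R in n0 *.
  set ep := evalc F q p; set en := evalc F q n.
  rewrite /ltle; case: (_ || _) => h.
    by rewrite ltr_pdivrMr // mulrAC ltr_ndivlMr //; nra.
  by rewrite ler_pdivrMr // mulrAC ler_ndivlMr //; nra.
exists (fun u => if u == t then x else q u) => c cL.
have -> : evalc (t :: F) (fun u => if u == t then x else q u) c =
    (c.1 t)%:~R * x + evalc F q c.
  rewrite /evalc big_cons eqxx; congr (_ + _).
  by apply: eq_big_seq => u uF'; case: eqVneq uF' tF => // -> ->.
have [c0|c0|c0] := ltgtP (c.1 t) 0.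
- have /xup /= : (- evalc F q c / (c.1 t)%:~R, c.2) \in up.
    by apply/mapP; exists c => //; rewrite mem_filter c0.
  have {}c0 : (c.1 t)%:~R < (0 : rat) by rewrite ltrz0.
  rewrite /ltle; case: (c.2).
    by rewrite ltr_ndivlMr // => ?; nra.
  by rewrite ler_ndivlMr // => ?; nra.
- have /xlo /= : (- evalc F q c / (c.1 t)%:~R, c.2) \in lo.
    by apply/mapP; exists c => //; rewrite mem_filter c0.
  have {}c0 : (0 : rat) < (c.1 t)%:~R by rewrite ltr0z.
  rewrite /ltle; case: (c.2).
    by rewrite ltr_pdivrMr // => ?; nra.
  by rewrite ler_pdivrMr // => ?; nra.
- rewrite c0 mul0r add0r; apply: qP.
  by rewrite mem_cat mem_filter c0 eqxx cL.
Qed.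

End FourierMotzkin.

(** * Rational valuations of chains *)

Section Chain.
Variable C : mvType.
Hypothesis mvle_total : forall x y : C, mvle x y \/ mvle y x.
Hypothesis mv01 : (mv0 : C) <> mv1.
Implicit Types (x y z : C) (p q r : nat * C) (A B : seq {classic C}).

(* A pair [(n, z)] with [z <> mv1] stands for the element [n + z] of the
   ordered group in which [C] is the unit interval. *)
Definition carry x p : nat * C :=
  if `[< mvadd x p.2 = mv1 >] then (p.1.+1, mvmul x p.2)
  else (p.1, mvadd x p.2).

Definition evseq A : nat * C := foldr carry (0%N, mv0) A.

Definition mvlt x y := mvle x y /\ x <> y.

(** The order of that group, lexicographic on pairs; [s] demands strictness, as in [ltle]. *)
Definition pair_rel (s : bool) p q :=
  (~~ s /\ p = q) \/ ((p.1 < q.1)%N \/ p.1 = q.1 /\ mvlt p.2 q.2).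

Variant carry_spec x n z : nat * C -> Prop :=
| CarryFull of mvadd x z = mv1 & mvle (mvneg x) z & mvle (mvneg z) x :
    carry_spec x n z (n.+1, mvmul x z)
| CarryNone of mvadd x z <> mv1 & mvle x (mvneg z) & mvle z (mvneg x) :
    carry_spec x n z (n, mvadd x z).

(** In a chain [mvadd x z] either reaches [mv1] or does not truncate; each case supplies the
    inequalities needed for cancellation. *)
Lemma carryP x n z : carry_spec x n z (carry x (n, z)).
Proof.
rewrite /carry /=; case: asboolP => xz; constructor => //.
- by rewrite /mvle mvnegK.
- by rewrite /mvle mvnegK mvaddC.
- have [] := mvle_total x (mvneg z) => //.
  by rewrite /mvle mvnegK mvaddC => /xz.
- have [] := mvle_total z (mvneg x) => //.
  by rewrite /mvle mvnegK => /xz.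
Qed.

Lemma mvle_lt1 x y : mvle x y -> y <> mv1 -> x <> mv1.
Proof.
by move=> xy y1 x1; apply: y1; apply: mvle_anti; [exact: mvlex1|rewrite -x1].
Qed.

Lemma carry_lt1 x p : p.2 <> mv1 -> (carry x p).2 <> mv1.
Proof.
case: p => n z /= z1; case: carryP => //= _ _ _.
exact: mvle_lt1 (mvle_mull _ _) z1.
Qed.

(** This and the next two identities are the cases of [carryC], according to whether neither, both
    or one of [x], [y] carries over [z]. All sides are [x + y + z - 1] truncated to the unit
    interval. *)
Lemma mul_add_swap x y z : mvle x (mvneg z) -> mvle y (mvneg z) ->
  mvmul x (mvadd y z) = mvmul y (mvadd x z).
Proof.
move=> xz yz; rewrite -{1}(mvlexN_subK xz) -{2}(mvlexN_subK yz).
by rewrite -!mvmulA !(mvaddC z) [mvmul (mvadd x z) _]mvmulC.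
Qed.

Lemma add_mul_swap x y z : mvle (mvneg z) x -> mvle (mvneg z) y ->
  mvadd x (mvmul y z) = mvadd y (mvmul x z).
Proof.
move=> /mvle_subK + /mvle_subK; rewrite mvnegK => xz yz.
by rewrite -{1}xz -{2}yz -!mvaddA [mvadd (mvmul x z) _]mvaddC.
Qed.

Lemma add_mul_exchange x y z : mvle y (mvneg z) -> mvle z (mvneg y) ->
  mvle (mvneg z) x -> mvadd y (mvmul x z) = mvmul x (mvadd y z).
Proof.
move=> yz zy zx; rewrite -{1}(mvlexN_subK zy) mvmulCA (mvmulC (mvneg y)).
apply: mvle_subK; rewrite -{1}(mvlexN_subK yz) (mvaddC z).
by rewrite !(mvmulC _ (mvadd _ _)); exact: mvle_mul2l.
Qed.

Lemma carryC x y p : p.2 <> mv1 -> carry x (carry y p) = carry y (carry x p).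
Proof.
case: p => n z /= z1.
(* If only [v] carries over [z], exactly one carry occurs in either order. *)
have mixed u v : mvadd v z = mv1 -> mvle (mvneg z) v -> mvadd u z <> mv1 ->
    mvle u (mvneg z) -> mvle z (mvneg u) ->
    carry u (n.+1, mvmul v z) = carry v (n, mvadd u z).
  move=> vz zv uz1 uz zu; rewrite /carry /= mvaddCA vz mvaddx1.
  rewrite add_mul_exchange //; case: asboolP => [h|_]; last by rewrite asboolT.
  by case: (mvle_lt1 (mvle_mull _ _) uz1 h).
case: (carryP y n z) => yz yz' zy; case: (carryP x n z) => xz xz' zx.
- by rewrite /carry /= (add_mul_swap zx zy) mvmulCA.
- by apply: mixed.
- by symmetry; apply: mixed.
- by rewrite /carry /= mvaddCA (mul_add_swap xz' yz').
Qed.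

Lemma pair_rel_carry x s p q : p.2 <> mv1 -> q.2 <> mv1 ->
  pair_rel s p q -> pair_rel s (carry x p) (carry x q).
Proof.
move=> p1 q1 [[s0 ->]|pq]; first by left.
right; case: p q p1 q1 pq => [n z] [m w] /= z1 w1.
have ltmul : mvle (mvneg x) z -> mvmul x z <> x.
  move=> /mvle_subK; rewrite mvnegK mvmulC => h xz; apply: z1.
  by rewrite -h xz mvaddNx.
case: (carryP x n z) => xz xz' zx; case: (carryP x m w) => xw xw' wx /=.
- rewrite ltnS => -[|[-> [zw neq]]]; [by left|right; split=> //].
  split=> [|h]; first exact: mvle_mul2l.
  apply: neq; rewrite -(mvle_subK xz') -(mvle_subK xw') !mvnegK.
  by rewrite mvmulC h mvmulC.
(* [z] carries and [w] does not, which forces [n < m]; when [n.+1 = m], strictness comes from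
   [mvmul x z] lying strictly below [x]. *)
- case=> [|[_ [zw _]]]; last first.
    by exfalso; apply: xw; apply: mvle_anti; [exact: mvlex1|];
       rewrite -xz; exact: mvle_add2l.
  rewrite leq_eqVlt => /predU1P[<-|]; [right; split=> //|by left].
  have le : mvle (mvmul x z) x := mvle_mulr _ _.
  split=> [|h]; first exact: mvle_trans le (mvle_addr _ _).
  by apply: ltmul => //; apply: mvle_anti => //; rewrite h; exact: mvle_addr.
- by case=> [/ltnW|[->]]; left; rewrite ltnS.
- case=> [|[-> [zw neq]]]; [by left|right; split=> //].
  split=> [|h]; first exact: mvle_add2l.
  by apply: neq; rewrite -(mvlexN_subK zx) -(mvlexN_subK wx) h.
Qed.

Lemma pair_rel_trans s t q p r :
  pair_rel s p q -> pair_rel t q r -> pair_rel (s || t) p r.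
Proof.
move=> [[s0 ->]|pq] [[t0 qr]|qr]; rewrite /pair_rel.
- by left; rewrite negb_or s0.
- by right.
- by right; rewrite -qr.
- right; case: pq qr => [pq|[-> [pq npq]]] [qr|[<- [qr nqr]]].
  + by left; exact: ltn_trans pq qr.
  + by left.
  + by left.
  + right; split=> //; split=> [|h]; first exact: mvle_trans qr.
    by apply: npq; apply: mvle_anti => //; rewrite h.
Qed.

Lemma pair_rel_irr p : ~ pair_rel true p p.
Proof. by case=> [[]//|[|[_ []//]]]; rewrite ltnn. Qed.

Lemma evseq_lt1 A : (evseq A).2 <> mv1.
Proof. by elim: A => [|x A IH] //=; exact: carry_lt1. Qed.

Lemma evseq_perm A B : perm_eq A B -> evseq A = evseq B.
Proof.
elim: A B => [|x A IH] B; first by rewrite perm_sym => /perm_nilP ->.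
move=> xAB; have xB : x \in B by rewrite -(perm_mem xAB) mem_head.
case/splitPr: xB xAB => B1 B2; rewrite perm_sym -(cat1s x B2) perm_catCA /=.
rewrite perm_cons perm_sym => /IH ->; elim: B1 => [|y B1 IHB] //=.
by rewrite -IHB carryC //; exact: evseq_lt1.
Qed.

Lemma pair_rel_cat s A B D :
  pair_rel s (evseq A) (evseq B) ->
  pair_rel s (evseq (D ++ A)) (evseq (D ++ B)).
Proof.
elim: D => [|x D IH] //= AB; apply: pair_rel_carry; [exact: evseq_lt1..|].
exact: IH.
Qed.

Local Open Scope ring_scope.

Lemma sum_count (T : eqType) (F A : seq T) (q : T -> rat) :
  uniq F -> {subset A <= F} ->
  \sum_(t <- F) (count_mem t A)%:R * q t = \sum_(t <- A) q t.
Proof.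
move=> uF; elim: A => [|a A IH] AF.
  by rewrite big_nil big1 // => t _; rewrite mul0r.
rewrite big_cons -IH; last by move=> t tA; apply: AF; rewrite inE tA orbT.
under eq_bigr do rewrite /= natrD mulrDl.
rewrite big_split /=; congr (_ + _).
rewrite (bigD1_seq a) //=; last by apply: AF; rewrite mem_head.
rewrite eqxx mul1r big1 ?addr0 // => t ta.
by rewrite eq_sym (negPf ta) mul0r.
Qed.

(** A comparison of two lists is encoded by the differences of multiplicities. Such constraints add
    up by concatenation, because the order is translation invariant. A strict one with all
    coefficients zero would compare permuted lists, whose values agree. [V] ranges over all lists in
    [F], as additive closure leaves [S]. *)
Lemma chain_valuation (S : seq (seq {classic C})) :
  exists q : {classic C} -> rat, forall s A B, A \in S -> B \in S ->
    pair_rel s (evseq A) (evseq B) ->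
    ltle s (\sum_(t <- A) q t) (\sum_(t <- B) q t).
Proof.
pose F := undup (flatten S).
have SF A : A \in S -> {subset A <= F}.
  by move=> AS t tA; rewrite mem_undup; apply/flattenP; exists A.
pose mk A B s : constr {classic C} :=
  (fun t => (count_mem t B)%:Z - (count_mem t A)%:Z, s).
pose V : set (constr {classic C}) := [set c | exists A B,
  [/\ {subset A <= F}, {subset B <= F}, c = mk A B c.2 &
      pair_rel c.2 (evseq A) (evseq B)]].
pose L := [seq mk AB.1 AB.2 s | AB <- [seq (A, B) | A <- S, B <- S],
  s <- [seq s <- [:: true; false] |
         `[< pair_rel s (evseq AB.1) (evseq AB.2) >]]].
have [||||q qP] := @additive_constr_sat _ F V L.
- exact: undup_uniq.
- move=> c d [A [B [AF BF -> AB]]] [A' [B' [AF' BF' -> AB']]].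
  exists (A ++ A'), (B ++ B'); split=> /=.
  + by move=> t; rewrite mem_cat => /orP[/AF|/AF'].
  + by move=> t; rewrite mem_cat => /orP[/BF|/BF'].
  + rewrite /addc /mk /=; congr pair; apply/funext => t.
    by rewrite !count_cat !PoszD opprD addrACA.
  + rewrite orbC; apply: (@pair_rel_trans _ _ (evseq (A ++ B'))).
      exact: pair_rel_cat.
    rewrite (evseq_perm (permEl (perm_catC A B'))).
    rewrite (evseq_perm (permEl (perm_catC B B'))); exact: pair_rel_cat.
- move=> c [A [B [AF BF cE +]]] c2; rewrite c2 => AB.
  apply: contrapT => h; suff : perm_eq A B.
    by move=> /evseq_perm E; rewrite E in AB; exact: pair_rel_irr AB.
  apply/allP => t tAB; apply: contrapT => ct; apply: h; exists t.
    by move: tAB; rewrite mem_cat => /orP[/AF|/BF].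
  by rewrite cE /= subr_eq0 eqz_nat eq_sym; apply/negP.
- move=> c /allpairsPdep[[A B] [s [/allpairsP[[A' B'] [AS BS [-> ->]]] + ->]]].
  rewrite mem_filter => /andP[/asboolP AB _].
  by exists A', B'; split=> //; exact: SF.
exists q => s A B AS BS AB.
have := qP (mk A B s); rewrite /evalc /=.
have -> : mk A B s \in L.
  apply/allpairsPdep; exists (A, B), s; split=> //.
    by apply/allpairsP; exists (A, B).
  by rewrite mem_filter asboolT //=; case: (s).
under eq_bigr do rewrite rmorphB /= mulrBl.
rewrite sumrB !sum_count ?undup_uniq //; [|exact: SF..].
by move=> /(_ isT); rewrite /ltle; case: s {AB}; rewrite (subr_gt0, subr_ge0).
Qed.

End Chain.

(** * Local morphisms into powers of the rational unit interval *)

Definition mv_local_morphism (M N : mvType) (F : set M) (v : M -> N) :=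
  [/\ forall x y, F x -> F y -> F (mvadd x y) ->
        v (mvadd x y) = mvadd (v x) (v y),
      forall x, F x -> F (mvneg x) -> v (mvneg x) = mvneg (v x) &
      F mv0 -> v mv0 = mv0].

Lemma mvlt_total (C : mvType) :
  (forall x y : C, mvle x y \/ mvle y x) ->
  forall x y : C, x <> y -> mvlt x y \/ mvlt y x.
Proof.
move=> tot x y xy; have [] := tot x y; [left|right]; split=> //.
by move=> yx; exact: xy.
Qed.

Section ChainMorphism.
Local Open Scope ring_scope.

Lemma chain_local_morphism (C : mvType) (F : seq {classic C}) (a b : C) :
  (forall x y : C, mvle x y \/ mvle y x) -> a <> b ->
  exists v : C -> unitI rat, mv_local_morphism [set` F] v /\ v a <> v b.
Proof.
move=> tot ab.
have mv01 : (mv0 : C) <> mv1.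
  move=> h; apply: ab; have all1 (x : C) : x = mv1.
    by rewrite -(mvaddx0 x) h mvaddx1.
  by rewrite (all1 a) (all1 b).
pose F' : seq {classic C} := [:: mv0, mv1, a, b & F].
(* The empty list pins [q mv0] to zero, singletons give monotonicity, and pairs control [mvadd] and
   [mvneg]. *)
pose S := [::] :: [seq [:: x] | x <- F'] ++ [seq [:: x; y] | x <- F', y <- F'].
have [q qP] := chain_valuation tot mv01 S.
have S0 : [::] \in S by rewrite mem_head.
have S1 x : x \in F' -> [:: x] \in S.
  by move=> xF; rewrite inE mem_cat (map_f (fun x => [:: x])) ?orbT.
have S2 x y : x \in F' -> y \in F' -> [:: x; y] \in S.
  move=> xF yF; rewrite inE mem_cat; apply/orP; right; apply/orP; right.
  by apply/allpairsP; exists (x, y).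
have F0 : (mv0 : {classic C}) \in F' by rewrite !inE eqxx.
have F1 : (mv1 : {classic C}) \in F' by rewrite !inE eqxx !orbT.
have Fa : (a : {classic C}) \in F' by rewrite !inE eqxx !orbT.
have Fb : (b : {classic C}) \in F' by rewrite !inE eqxx !orbT.
have FF x : x \in F -> x \in F' by move=> xF; rewrite !inE xF !orbT.
have ev1 (x : C) : x <> mv1 -> carry x (0%N, mv0) = (0%N, x).
  by rewrite /carry /= mvaddx0 => x1; rewrite asboolF.
(* Fractional parts differ from [mv1], so the unit is encoded as one full carry. *)
have ev11 : carry (mv1 : C) (0%N, mv0) = (1%N, mv0).
  by rewrite /carry /= mvaddx0 asboolT // mvmulx0.
have evle (x y : C) : mvlt x y ->
    pair_rel true (carry x (0%N, mv0)) (carry y (0%N, mv0)).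
  move=> [xy nxy]; have x1 : x <> mv1.
    by move=> x1; apply: nxy; apply: mvle_anti xy _; rewrite x1; exact: mvlex1.
  rewrite ev1 //; have [->|y1] := pselect (y = mv1).
    by rewrite ev11; right; left.
  by rewrite ev1 //; right; right.
have relW s (p r : nat * C) : pair_rel s p r -> pair_rel false p r.
  by case=> [[_ ->]|?]; [left|right].
have qlt x y : x \in F' -> y \in F' -> mvlt x y -> q x < q y.
  move=> xF yF /evle xy.
  by have := qP true _ _ (S1 _ xF) (S1 _ yF) xy; rewrite !big_seq1.
have q0 : q mv0 = 0.
  apply/le_anti/andP; split.
  - have := qP false _ _ (S1 _ F0) S0; rewrite big_seq1 big_nil; apply.
    by left; rewrite /= ev1.
  - have := qP false _ _ S0 (S1 _ F0); rewrite big_seq1 big_nil; apply.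
    by left; rewrite /= ev1.
have q1 : 0 < q mv1.
  by rewrite -q0; apply: qlt => //; split=> //; exact: mvlex1.
have qle x y : x \in F' -> y \in F' -> mvle x y -> q x <= q y.
  move=> xF yF xy; have [->//|nxy] := pselect (x = y).
  exact/ltW/qlt.
(* When the sum reaches [mv1] only an inequality is available; the minimum in [unitI_add] turns it
   into an equality. *)
have qadd1 x y : x \in F' -> y \in F' -> mvadd x y = mv1 -> q mv1 <= q x + q y.
  move=> xF yF xy; have := qP false _ _ (S1 _ F1) (S2 _ _ xF yF).
  rewrite !big_cons !big_nil !addr0; apply; rewrite /= ev11.
  have [y1|y1] := pselect (y = mv1).
    rewrite y1 ev11 /carry /= mvaddx0; case: asboolP => x1.
      by right; left.
    rewrite /pair_rel/=; have [->|x0] := pselect (x = mv0); first by left.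
    by right; right; split=> //; split; [exact: mvle0x|exact/nesym].
  rewrite (ev1 y) // /carry /= asboolT //.
  have [h|h] := pselect (mvmul x y = mv0); first by left; rewrite h.
  by right; right; split=> //; split; [exact: mvle0x|exact/nesym].
have qadd x y : x \in F' -> y \in F' -> mvadd x y \in F' ->
    mvadd x y <> mv1 -> q (mvadd x y) = q x + q y.
  move=> xF yF xyF xy.
  have y1 : y <> mv1 by move=> y1; apply: xy; rewrite y1 mvaddx1.
  have E : evseq [:: x; y] = evseq [:: mvadd x y : {classic C}].
    by rewrite /= ev1 // ev1 // /carry /= asboolF.
  have := qP false _ _ (S1 _ xyF) (S2 _ _ xF yF).
  have := qP false _ _ (S2 _ _ xF yF) (S1 _ xyF).
  rewrite !big_cons !big_nil !addr0 E => h1 h2.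
  by apply/le_anti/andP; split; [apply: h2; left|apply: h1; left].
have qneg x : x \in F' -> mvneg x \in F' -> q (mvneg x) = q mv1 - q x.
  move=> xF nxF; apply/eqP; rewrite eq_sym subr_eq addrC; apply/eqP.
  apply/le_anti/andP; split; first by apply: qadd1 => //; exact: mvaddxN.
  have := qP false _ _ (S2 _ _ nxF xF) (S1 _ F1).
  rewrite !big_cons !big_nil !addr0 addrC; apply; left; split=> //=.
  rewrite ev11; have [x1|x1] := pselect (x = mv1).
    by rewrite x1 ev11 mvneg1 /carry /= mvaddx0 asboolF.
  by rewrite ev1 // /carry /= mvaddNx asboolT // mvmulC mvmulxN.
(* Division by [q mv1] normalises the unit; on [F'] the quotient lies in [[0,1]], so the default of
   [insubd] is not taken. *)
pose v (x : C) : unitI rat := insubd (mv0 : unitI rat) (q x / q mv1).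
have vE x : x \in F' -> val (v x) = q x / q mv1.
  move=> xF; apply: insubdK; apply/andP; split.
    by rewrite divr_ge0 ?(ltW q1) // -q0; apply: qle => //; exact: mvle0x.
  by rewrite ler_pdivrMr // mul1r; apply: qle => //; exact: mvlex1.
have q1' : q mv1 != 0 by rewrite gt_eqF.
exists v; split; last first.
  move=> /(congr1 val); rewrite !vE // => /(divIf q1') qab.
  case: (mvlt_total tot ab) => lt_ab.
    by have := qlt _ _ Fa Fb lt_ab; rewrite qab ltxx.
  by have := qlt _ _ Fb Fa lt_ab; rewrite qab ltxx.
split=> /= [x y /FF xF /FF yF /FF xyF|x /FF xF /FF nxF|_]; apply: val_inj.
- rewrite [RHS]/= !vE // -mulrDl; have [xy|xy] := pselect (mvadd x y = mv1).
    rewrite xy divff // min_r // ler_pdivlMr // mul1r; exact: qadd1.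
  rewrite -qadd // min_l // ler_pdivrMr // mul1r.
  by apply: qle => //; exact: mvlex1.
- by rewrite [RHS]/= !vE // qneg // mulrBl divff.
- by rewrite vE // q0 mul0r.
Qed.

End ChainMorphism.

Lemma mv_local_separation (M : mvType) (F : seq {classic M}) (a b : M) :
  a <> b ->
  exists v : M -> unitI rat, mv_local_morphism [set` F] v /\ v a <> v b.
Proof.
move=> /mv_chain_separation[C [f [[fadd fneg f0] tot fab]]].
have [v [[vadd vneg v0] vab]] :=
  chain_local_morphism (map (f : {classic M} -> {classic C}) F) tot fab.
have Ff (x : M) : [set` F] x ->
    [set` map (f : {classic M} -> {classic C}) F] (f x).
  by move=> /= xF; exact: (map_f (f : {classic M} -> {classic C})).
exists (v \o f); split=> //; split=> [x y Fx Fy Fxy|x Fx Fnx|Fz] /=.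
- rewrite fadd vadd //; [exact: Ff..|rewrite -fadd; exact: Ff].
- rewrite fneg vneg //; [exact: Ff|rewrite -fneg; exact: Ff].
- by rewrite f0 v0 // -f0; exact: Ff.
Qed.

Lemma mv_local_embedding (M N : mvType) (F : set M) :
  (mv0 : M) <> mv1 -> mv_embeds (unitI rat) N -> finite_set F ->
  exists h : M -> mvpow N nat, mv_local_morphism F h /\
    forall x y, F x -> F y -> h x = h y -> x = y.
Proof.
move=> M01 [e [[eadd eneg e0] einj]].
move=> /(@finite_seqP {classic M})[s sF].
have /choice[v vP] (p : M * M) : exists v : M -> unitI rat,
    mv_local_morphism F v /\ (p.1 <> p.2 -> v p.1 <> v p.2).
  rewrite sF; have [p12|/(mv_local_separation s)[v [? ?]]] :=
    pselect (p.1 = p.2); last by exists v.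
  (* For a pair of equal elements any local morphism serves, such as one separating [mv0] from
     [mv1]. *)
  by have [v [? _]] := mv_local_separation s M01; exists v.
pose P : seq ({classic M} * {classic M}) := [seq (x, y) | x <- s, y <- s].
(* Coordinate [n] separates the [n]-th pair; past the end of [P] the default pair is used. *)
pose w n := v (nth (mv0 : {classic M}, mv0 : {classic M}) P n).
exists (fun x n => e (w n x)); split.
  split=> [x y Fx Fy Fxy|x Fx Fnx|F0]; apply/funext => n;
    rewrite /w; have [[vadd vneg v0] _] := vP (nth (mv0, mv0) P n).
  - by rewrite vadd // eadd.
  - by rewrite vneg // eneg.
  - by rewrite v0 // e0.
move=> x y; rewrite sF /= => xs ys.
pose xy : {classic M} * {classic M} := (x, y).
move=> /(congr1 (fun h : nat -> N => h (index xy P))) /einj.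
rewrite /w nth_index; last by apply/allpairsP; exists xy.
by move=> vxy; apply: contrapT => nxy; have [_ /(_ nxy)] := vP (x, y).
Qed.

(** * Ultraproducts over finite subsets *)

Section Regular.
Variable K : Type.

Definition finsubsets_above (k : K) : set (finsubset K) := [set X | sval X k].

(** The cones over finite sets generate a proper filter: the cones over [Y] and [Z] meet in the cone
    over their union, and each contains its vertex. *)
Lemma ultrafilter_above_exists : exists U : set_system (finsubset K),
  UltraFilter U /\ forall k, U (finsubsets_above k).
Proof.
pose G : set_system (finsubset K) := [set S | exists Y : finsubset K,
  forall X : finsubset K, sval Y `<=` sval X -> S X].
have GP : ProperFilter G.
  apply: Build_ProperFilter_ex.
    by move=> S [Y YS]; exists Y; exact: YS.
  split.
  - by exists (exist _ set0 (finite_set0 K)).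
  - move=> S T [Y YS] [Z ZT].
    have YZ : finite_set (sval Y `|` sval Z).
      by rewrite finite_setU; split; exact: svalP.
    exists (exist _ _ YZ) => X /= YZX; split.
    + by apply: YS => k Yk; apply: YZX; left.
    + by apply: ZT => k Zk; apply: YZX; right.
  - by move=> S T ST [Y YS]; exists Y => X /YS /ST.
have [U [UU GU]] := ultraFilterLemma GP.
exists U; split=> // k; apply: GU.
by exists (exist _ [set k] (finite_set1 k)) => X; apply.
Qed.

(** A finite [X] lies in [finsubsets_above k] only for [k] in [X]. The singleton of [k]
    distinguishes this set from the others. *)
Lemma regular_filter_above (U : set_system (finsubset K)) :
  ProperFilter U -> (forall k, U (finsubsets_above k)) -> regular_filter K U.
Proof.
move=> UP Uk; split=> //; exists (range finsubsets_above); split.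
- by move=> _ [k _ <-].
- apply: inj_card_eq => k l _ _ kl.
  have : finsubsets_above k (exist _ [set k] (finite_set1 k)) by [].
  by rewrite kl.
- move=> X; apply: (@sub_finite_set _ _ (finsubsets_above @` sval X)).
    by move=> _ [[k _ <-] kX]; exists k.
  exact/finite_image/svalP.
Qed.

(** Pulled back along an injection [g] of [M] into [K], each [X] gives a finite part of [M],
    embedded locally by [h X]. An instance of a morphism law involves at most three elements, and
    [U]-almost every [X] contains their images; for injectivity one such [X] suffices. *)
Lemma mv_embeds_ultraprod (U : set_system (finsubset K)) (UU : UltraFilter U)
    (M N : mvType) : (forall k, U (finsubsets_above k)) ->
  (mv0 : M) <> mv1 -> ([set: M] #<= [set: K])%card ->
  mv_embeds (unitI rat) N ->
  mv_embeds M (mvultraprod UU (fun=> mvpow N nat)).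
Proof.
move=> Uk M01 /card_leP[g0] emb.
pose g (x : M) : K := val (g0 (SigSub (mem_set (I : [set: M] x)))).
have ginj (x y : M) : g x = g y -> x = y.
  by move=> /val_inj/(inj (in_setT _) (in_setT _))/(congr1 val).
have fin (X : finsubset K) : finite_set (g @^-1` sval X).
  by apply: finite_preimage; [move=> x y _ _; exact: ginj|exact: svalP].
have /choice[h hP] (X : finsubset K) := mv_local_embedding M01 emb (fin X).
pose A := fun _ : finsubset K => mvpow N nat.
pose f (x : M) : mvprod A := fun X => h X x.
have Ug x : U [set X | sval X (g x)] := Uk (g x).
exists (fun x => \pi_(mvredprod _ A) (f x)); split; first split.
- move=> x y; rewrite /mvadd /= !piE; apply/eqmodP/asboolP.
  apply: filterS3 (Ug x) (Ug y) (Ug (mvadd x y)) => X /= Xx Xy Xxy.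
  by have [[hadd _ _] _] := hP X; exact: hadd.
- move=> x; rewrite /mvneg /= !piE; apply/eqmodP/asboolP.
  apply: filterS2 (Ug x) (Ug (mvneg x)) => X /= Xx Xnx.
  by have [[_ hneg _] _] := hP X; exact: hneg.
- rewrite /mv0 /= !piE; apply/eqmodP/asboolP.
  apply: filterS (Ug mv0) => X /= X0.
  by have [[_ _ h0] _] := hP X; exact: h0.
- move=> x y /eqmodP/asboolP Uxy.
  have [X [Xxy [Xx Xy]]] := filter_ex (filterI Uxy (filterI (Ug x) (Ug y))).
  by have [_ hinj] := hP X; exact: hinj.
Qed.

End Regular.

(** The one-element algebra is set apart by [mv0 <> mv1]: a morphism would carry [mv0 = mv1] over to
    the ultrapower, where it fails. *)
Theorem theorem12 (R : realType) (K : Type)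
    (K_infinite : infinite_set [set: K]) :
  exists (U : set_system (finsubset K)) (UU : UltraFilter U),
    regular_filter K U /\
    forall M : mvType, (mv0 : M) <> mv1 -> ([set: M] #<= [set: K])%card ->
      mv_embeds M (mvultraprod UU (fun=> mvpow (unitI rat) nat)) /\
      mv_embeds M (mvultraprod UU (fun=> mvpow (unitI R) nat)).
Proof.
have [U [UU Uk]] := ultrafilter_above_exists K.
exists U, UU; split; first exact: regular_filter_above.
move=> M M01 MK; split; apply: mv_embeds_ultraprod => //.
  by exists id; split=> //; split.
by have [e [? ? _]] := unitI_rat_subalgebra R; exists e.
Qed.
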